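(* Let $\varphi:\mathbb{R}_+\to\mathbb{R}_+$ be a convex admissible function with right derivative $\varphi'_+$. Let $f:X\to\mathbb{R}\cup\{+\infty\}$ be a proper lower semicontinuous function on a Banach space $X$ and let $\bar x\in{\rm dom}(f)$ be a local minimizer of $f$. Suppose that the Clarke-Rockafellar subdifferential mapping $\partial f$ is strongly metrically $\varphi'_+$-regular at $(\bar x,0)$. Then $f$ has $\varphi$-SLWP at $\bar x$.
   Context: $\mathbb{R}_+=[0,+\infty)$; $B_X(x,r)$ and $B_X[x,r]$ are the open and closed balls; ${\rm dom}(f)=\{x: f(x)<+\infty\}$; $X^*$ is the dual of $X$, and $f_{u^*}(x):=f(x)-\langle u^*,x\rangle$ for $u^*\in X^*$. Admissible function: a nondecreasing $\varphi:\mathbb{R}_+\to\mathbb{R}_+$ with $\varphi(0)=0$ such that $\varphi(t)\to0$ implies $t\to0$. $\varphi'_+(t):=\lim_{s\to0^+}\frac{\varphi(t+s)-\varphi(t)}{s}$. $\varphi$-SLWP (stable local well-posedness with respect to $\varphi$) of $f$ at $\bar x\in{\rm dom}(f)$: there exist $\delta,r,\tau,\kappa\in(0,+\infty)$ such that for every $u^*\in B_{X^*}(0,\delta)$ there is $x_{u^*}\in B_X[\bar x,r]$, with $x_0=\bar x$, satisfying $\varphi(\kappa\|x-x_{u^*}\|)\le\tau(f_{u^*}(x)-f_{u^*}(x_{u^*}))$ for all $x\in B_X[\bar x,r]$. Clarke-Rockafellar subdifferential: for $x\in{\rm dom}(f)$, $\partial f(x):=\{x^*\in X^*:\langle x^*,h\rangle\le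 f^\uparrow(x,h)\ \forall h\in X\}$, where $f^\uparrow(x,h):=\lim_{\varepsilon\downarrow0}\limsup_{u\to x,\,f(u)\to f(x),\,t\downarrow0}\inf_{\|w-h\|\le\varepsilon}\frac{f(u+tw)-f(u)}{t}$; $\partial f(x)=\emptyset$ for $x\notin{\rm dom}(f)$. Metric regularity: let $\psi$ be an admissible function and $F:X\rightrightarrows Y$ a multifunction between Banach spaces, $(\bar x,\bar y)\in{\rm gph}(F)=\{(x,y): y\in F(x)\}$, $F^{-1}(y)=\{x: y\in F(x)\}$. $F$ is metrically $\psi$-regular at $(\bar x,\bar y)$ if there exist $r,\tau,\kappa\in(0,+\infty)$ with $\psi(\tau d(x,F^{-1}(y)))\le\kappa d(y,F(x))$ for all $(x,y)\in B_X(\bar x,r)\times B_Y(\bar y,r)$. $F$ is strongly metrically $\psi$-regular at $(\bar x,\bar y)$ if there exist $r,\tau,\kappa,\delta\in(0,+\infty)$ such that this inequality holds and $F^{-1}(y)\cap B_X(\bar x,\delta)$ is a singleton for all $y\in B_Y(\bar y,r)$. Here $d(x,A)=\inf_{a\in A}\|x-a\|$, $d(x,\emptyset)=+\infty$, and $\psi(+\infty):=\lim_{t\to+\infty}\psi(t)$. As the definition is for admissible functions, strong metric $\varphi'_+$-regularity includes the requirement that $\varphi'_+$ be admissible (i.e. $\varphi'_+(0)=0$). *)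

(* Defs.v *)
From HB Require Import structures.
From mathcomp Require Import all_boot all_order all_algebra.
From mathcomp Require Import all_classical all_reals all_analysis.

Set Implicit Arguments.
Unset Strict Implicit.
Unset Printing Implicit Defensive.

Import Order.TTheory GRing.Theory Num.Def Num.Theory.
Import numFieldNormedType.Exports.

Local Open Scope classical_set_scope.
Local Open Scope ring_scope.

Section dual_carrier.
Context (R : realType) (X : normedModType R).

Definition continuous_linear_form : {pred X -> R^o} :=
  fun u => `[< linear u /\ continuous u >].

Lemma continuous_linear_form_submod_closed :
  submod_closed continuous_linear_form.
Proof.
split.
  apply/asboolP; split; first by move=> a x y /=; rewrite scaler0 addr0.
  by move=> x; exact: cvg_cst.
move=> a u v /asboolP[lu cu] /asboolP[lv cv]; apply/asboolP; split.
  move=> b x y /=; rewrite !fctE lu lv !scalerDr addrACA; congr (_ + _ + _).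
  by rewrite !scalerA mulrC.
move=> x; apply: cvgD; last exact: cv.
by apply: cvgZl_tmp; exact: cu.
Qed.

HB.instance Definition _ := GRing.isSubmodClosed.Build R (X -> R^o)
  continuous_linear_form continuous_linear_form_submod_closed.

Record dual := Dual {
  dual_fun :> X -> R^o;
  dual_funP : dual_fun \in continuous_linear_form }.

HB.instance Definition _ := [isSub for dual_fun].
HB.instance Definition _ := [Choice of dual by <:].
HB.instance Definition _ := [SubChoice_isSubLmodule of dual by <:].

Definition dual_norm (u : dual) : R :=
  sup [set `|u x| | x in [set x : X | `|x| <= 1]].

Lemma dual_linear (u : dual) : linear u.
Proof. by have /asboolP[] := dual_funP u. Qed.

Lemma dual_continuous (u : dual) : continuous u.
Proof. by have /asboolP[] := dual_funP u. Qed.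

Lemma dualZ (u : dual) (a : R) (x : X) : u (a *: x) = a * u x.
Proof.
have l0 : u 0 = 0.
  by have := dual_linear u (-1) 0 0; rewrite scaler0 addr0 scaleN1r addNr.
by have := dual_linear u a x 0; rewrite !addr0 l0 addr0.
Qed.

Lemma dual_has_sup (u : dual) :
  has_sup [set `|u x| | x in [set x : X | `|x| <= 1]].
Proof.
split; first by exists `|u 0|, 0 => //=; rewrite normr0.
have u0 : u 0 = 0 by have := dualZ u 0 0; rewrite scale0r mul0r.
have /cvgrPdist_lt /(_ 1 ltr01) := @dual_continuous u 0.
rewrite u0 => /nbhs_ballP[e /= e0 he].
exists (2 / e) => _ [x /= x1 <-].
have e2 : 0 < e / 2 by rewrite divr_gt0.
have he2 : `|(e / 2) *: x| < e.
  rewrite normrZ gtr0_norm//; apply: (@le_lt_trans _ _ (e / 2)).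
    by rewrite ler_piMr// ltW.
  by rewrite ltr_pdivrMr// ltr_pMr// ltr1n.
have {he he2} : `|u ((e / 2) *: x)| < 1.
  by have := he ((e / 2) *: x); rewrite -ball_normE /= !sub0r !normrN => /(_ he2).
rewrite dualZ normrM gtr0_norm// mulrC -ltr_pdivlMr// mul1r invf_div.
exact: ltW.
Qed.

Lemma dual_norm_bound (u : dual) (x : X) : `|u x| <= dual_norm u * `|x|.
Proof.
have [->|x0] := eqVneq x 0.
  by rewrite -(scale0r (0 : X)) dualZ mul0r scale0r !normr0 mulr0.
have nx0 : 0 < `|x| by rewrite normr_gt0.
rewrite -ler_pdivrMr//.
apply: (ub_le_sup (dual_has_sup u).2); exists (`|x|^-1 *: x) => /=.
  by rewrite normrZ normfV normr_id mulVf// normr_eq0.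
by rewrite dualZ normrM normfV normr_id mulrC.
Qed.

Lemma dual_norm_le (u : dual) (M : R) :
  (forall x : X, `|x| <= 1 -> `|u x| <= M) -> dual_norm u <= M.
Proof.
move=> h; apply: ge_sup; first exact: (dual_has_sup u).1.
by move=> _ [x /= x1 <-]; exact: h.
Qed.

Lemma dual_norm_ge0 (u : dual) : 0 <= dual_norm u.
Proof.
apply: le_trans (normr_ge0 (u 0)) _.
apply: (ub_le_sup (dual_has_sup u).2).
by exists 0 => //=; rewrite normr0.
Qed.

Lemma dual_ler_normD (u v : dual) :
  dual_norm (u + v) <= dual_norm u + dual_norm v.
Proof.
apply: dual_norm_le => x x1.
apply: le_trans (ler_normD (u x) (v x)) _.
apply: lerD; (apply: le_trans (dual_norm_bound _ _) _);
  by rewrite ler_piMr ?dual_norm_ge0.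
Qed.

Lemma dual_normrZ (a : R) (u : dual) :
  dual_norm (a *: u) = `|a| * dual_norm u.
Proof.
have le b (v : dual) : dual_norm (b *: v) <= `|b| * dual_norm v.
  apply: dual_norm_le => x x1.
  rewrite [X in X <= _](_ : _ = `|b| * `|v x|); last by rewrite -normrM.
  rewrite ler_wpM2l// (le_trans (dual_norm_bound _ _))//.
  by rewrite ler_piMr ?dual_norm_ge0.
apply/eqP; rewrite eq_le le /=.
have [->|a0] := eqVneq a 0; first by rewrite normr0 mul0r dual_norm_ge0.
rewrite -ler_pdivlMl ?normr_gt0// -normfV.
by rewrite -{1}(scalerK a0 u) le.
Qed.

Lemma dual_norm0_eq0 (u : dual) : dual_norm u = 0 -> u = 0.
Proof.
move=> u0; apply/val_inj/funext => x /=.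
by have := dual_norm_bound u x; rewrite u0 mul0r normr_le0 => /eqP.
Qed.

HB.instance Definition _ := Lmodule_isNormed.Build R dual
  dual_ler_normD dual_normrZ dual_norm0_eq0.

End dual_carrier.

(* A function R_+ -> R_+ is a total function on R of which only the values at
   nonnegative arguments are ever used. *)
Definition admissible (R : realType) (phi : R -> R) : Prop :=
  [/\ forall t : R, 0 <= t -> 0 <= phi t,
      forall s t : R, 0 <= s -> s <= t -> phi s <= phi t,
      phi 0 = 0
    & forall t : nat -> R, (forall n, 0 <= t n) ->
        phi (t n) @[n --> \oo] --> 0 -> t n @[n --> \oo] --> 0].

Definition right_derivative (R : realType) (phi : R -> R) (t : R) : R :=
  lim ((phi (t + s) - phi t) / s @[s --> 0^'+]).

(* Only applied to arguments in [0, +oo]. *)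
Definition extend_infty (R : realType) (psi : R -> R) (t : \bar R) : \bar R :=
  match t with
  | r%:E => (psi r)%:E
  | +oo%E => lim ((psi s)%:E @[s --> +oo])
  | -oo%E => 0%E
  end.

Definition dist_set (R : realType) (V : normedModType R) (x : V) (A : set V)
    : \bar R :=
  ereal_inf [set `|x - a|%:E | a in A].

Definition preimage_multi (X Y : Type) (F : X -> set Y) (y : Y) : set X :=
  [set x | F x y].

Definition metric_regular_ineq (R : realType) (X Y : normedModType R)
    (psi : R -> R) (F : X -> set Y) (xbar : X) (ybar : Y) (r tau kappa : R)
    : Prop :=
  forall (x : X) (y : Y), ball xbar r x -> ball ybar r y ->
    (extend_infty psi (tau%:E * dist_set x (preimage_multi F y))
       <= kappa%:E * dist_set y (F x))%E.

Definition strongly_metrically_regular (R : realType) (X Y : normedModType R)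
    (psi : R -> R) (F : X -> set Y) (xbar : X) (ybar : Y) : Prop :=
  [/\ admissible psi, F xbar ybar
    & exists r tau kappa delta : R,
        [/\ [/\ 0 < r, 0 < tau, 0 < kappa & 0 < delta],
            metric_regular_ineq psi F xbar ybar r tau kappa
          & forall y : Y, ball ybar r y ->
              exists a, preimage_multi F y `&` ball xbar delta = [set a]]].

Definition effective_domain (R : realType) (X : Type) (f : X -> \bar R)
    : set X :=
  [set x | (f x < +oo)%E].

Definition proper_function (R : realType) (X : Type) (f : X -> \bar R)
    : Prop :=
  (forall x, f x != -oo%E) /\ effective_domain f !=set0.

Definition local_minimizer (R : realType) (X : normedModType R)
    (f : X -> \bar R) (xbar : X) : Prop :=
  \forall x \near xbar, (f xbar <= f x)%E.

Definition tilt (R : realType) (X : normedModType R) (f : X -> \bar R)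
    (u : dual X) (x : X) : \bar R :=
  (f x - (u x : R)%:E)%E.

(* The filter of "u -> x and f(u) -> f(x)". *)
Definition f_attentive (R : realType) (X : normedModType R) (f : X -> \bar R)
    (x : X) : set_system X :=
  filter_from (nbhs (x, f x)) (fun V => [set u | V (u, f u)]).

(* The base point u = x is allowed in the limsup, t = 0 is not.  When f(x) is
   finite, points u with f(u) infinite are eventually excluded by the filter. *)
Definition upper_subderivative (R : realType) (X : normedModType R)
    (f : X -> \bar R) (x h : X) : \bar R :=
  lim (limf_esup
         (fun ut : X * R =>
            ereal_inf [set ((f (ut.1 + ut.2 *: w)%R - f ut.1) * (ut.2^-1)%:E)%E
                      | w in closed_ball_ normr h e])
         (filter_prod (f_attentive f x) 0^'+)
       @[e --> 0^'+]).

Definition subdifferential (R : realType) (X : normedModType R)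
    (f : X -> \bar R) (x : X) : set (dual X) :=
  [set u : dual X |
     effective_domain f x /\
     forall h, ((u h : R)%:E <= upper_subderivative f x h)%E].

Definition SLWP (R : realType) (X : normedModType R) (phi : R -> R)
    (f : X -> \bar R) (xbar : X) : Prop :=
  exists delta r tau kappa : R,
    [/\ 0 < delta, 0 < r, 0 < tau & 0 < kappa] /\
    exists m : dual X -> X,
      m 0 = xbar /\
      forall u : dual X, ball (0 : dual X) delta u ->
        closed_ball_ normr xbar r (m u) /\
        forall x, closed_ball_ normr xbar r x ->
          ((phi (kappa * `|x - m u|))%:E
             <= tau%:E * (tilt f u x - tilt f u (m u)))%E.

(* Main.v *)
(* Ekeland's principle applied to a tilted function f_u yields a point y that
   minimizes f_u + c |. - y| locally, and the subdifferential of f at such a y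
   contains some v with |v - u| <= c (the Clarke-Rockafellar sum rule for a
   Lipschitz convex perturbation, obtained by Hahn-Banach from the sublinearity
   of the upper subderivative).  Metric regularity then bounds
   phi'_+(tau |y - a|) by kappa c, where a is the only point near xbar with
   u in the subdifferential of f at a.

   If a minimizes f_u on a ball and the growth
   phi(tau/2 |x - a|) <= 2 kappa tau (f_u x - f_u a) failed at x, taking
   c = phi(tau/2 t) / (kappa tau t) with t = |x - a| would give
   |x - y| < t/2, hence phi'_+(tau t/2) <= kappa c, contradicting
   phi(s) <= s phi'_+(s) at s = tau t/2.  For u = 0 this is growth of f around
   xbar, which for small u keeps the near-minimizers of f_u away from the
   boundary of the ball; Ekeland with c arbitrarily small shows that they
   accumulate at a, so a minimizes f_u by lower semicontinuity, and the growth
   estimate applies again, with the same constants, at a. *)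
Require Import Defs.
From mathcomp Require Import all_boot all_order all_algebra.
From mathcomp Require Import all_classical all_reals all_analysis.
From mathcomp Require Import lra.
Set Implicit Arguments.
Unset Strict Implicit.
Unset Printing Implicit Defensive.

Import Order.TTheory GRing.Theory Num.Theory.
Import numFieldNormedType.Exports.
Local Open Scope classical_set_scope.
Local Open Scope ring_scope.

(** * Sublinear functions and the Hahn-Banach theorem *)

Definition sublinear (R : realType) (V : lmodType R) (p : V -> R) : Prop :=
  (forall x y, p (x + y) <= p x + p y) /\
  (forall a x, 0 < a -> p (a *: x) <= a * p x).

Lemma sublinear0 (R : realType) (V : lmodType R) (p : V -> R) :
  sublinear p -> p 0 = 0.
Proof.
move=> [_ hp].
(* The factor 2 gives [0 <= p 0] and the factor 1/2 gives [p 0 <= 0]. *)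
have h2 := hp 2 0 ltac:(by rewrite ltr0n).
have h3 := hp 2^-1 0 ltac:(by rewrite invr_gt0 ltr0n).
rewrite !scaler0 in h2 h3; lra.
Qed.

Lemma sublinear_homogeneous (R : realType) (V : lmodType R) (p : V -> R) a x :
  sublinear p -> 0 <= a -> p (a *: x) = a * p x.
Proof.
move=> sp; rewrite le_eqVlt => /orP[/eqP<-|a0].
  by rewrite scale0r mul0r sublinear0.
apply/eqP; rewrite eq_le sp.2//= -ler_pdivlMl//.
by rewrite -{1}(scalerK (lt0r_neq0 a0) x) sp.2// invr_gt0.
Qed.

(** Serves three times: for the competitor of a minimal sublinear function, for bounds of chains,
    and for the inf-convolution that produces a subgradient. *)
Lemma sublinear_inf (R : realType) (V : lmodType R) (S : V -> set R) :
  (forall x, S x !=set0) -> (forall x, has_lbound (S x)) ->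
  (forall x y a b, S x a -> S y b -> exists2 c, S (x + y) c & c <= a + b) ->
  (forall t x a, 0 < t -> S x a -> exists2 c, S (t *: x) c & c <= t * a) ->
  sublinear (fun x => inf (S x)).
Proof.
move=> S0 Sb SD SZ; split=> [x y|t x t0].
  rewrite -lerBlDr; apply: lb_le_inf => // a Sa.
  rewrite lerBlDr -lerBlDl; apply: lb_le_inf => // b Sb'.
  have [c Sc cab] := SD _ _ _ _ Sa Sb'.
  by rewrite lerBlDl; apply: le_trans cab; exact: ge_inf.
rewrite -ler_pdivrMl//; apply: lb_le_inf => // a /(SZ _ _ _ t0)[c Sc cta].
rewrite ler_pdivrMl//; by apply: le_trans cta; exact: ge_inf.
Qed.

(* Minimality forces p to agree with z |-> inf_{t >= 0} (p (z + t y) - t p y). *)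
Lemma minimal_sublinear_additive (R : realType) (V : lmodType R) (p : V -> R) :
  sublinear p ->
  (forall q, sublinear q -> (forall x, q x <= p x) -> q = p) ->
  forall x y, p (x + y) = p x + p y.
Proof.
move=> sp pmin x y.
pose S z := [set p (z + t *: y) - t * p y | t in [set t | 0 <= t]].
have Slb z c : S z c -> - p (- z) <= c.
  move=> [t /= t0 <-].
  have := sp.1 (z + t *: y) (- z).
  rewrite addrAC subrr add0r (sublinear_homogeneous _ sp)//; lra.
have Sb z : has_lbound (S z) by exists (- p (- z)) => c /Slb.
have S0 z : S z (p z) by exists 0 => //=; rewrite scale0r addr0 mul0r subr0.
have sq : sublinear (fun z => inf (S z)).
  apply: sublinear_inf => //.
  - by move=> z; exists (p z).
  - move=> z1 z2 _ _ [s /= s0 <-] [t /= t0 <-].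
    exists (p (z1 + z2 + (s + t) *: y) - (s + t) * p y).
      by exists (s + t) => //=; exact: addr_ge0.
    have := sp.1 (z1 + s *: y) (z2 + t *: y).
    rewrite addrACA -scalerDl mulrDl; lra.
  - move=> t z _ t0 [s /= s0 <-].
    exists (p (t *: z + (t * s) *: y) - (t * s) * p y).
      by exists (t * s) => //=; rewrite mulr_ge0// ltW.
    by rewrite mulrBr mulrA -scalerA -scalerDr lerD2r sp.2.
have qp : (fun z => inf (S z)) = p.
  by apply: pmin => // z; apply: ge_inf.
apply/eqP; rewrite eq_le sp.1/= -lerBrDr.
(* The parameter value 1 gives [p x <= p (x + y) - p y], the converse of subadditivity. *)
rewrite -[leLHS]/((fun z => p z) x) -{1}qp.
by apply: ge_inf => //; exists 1 => //=; rewrite scale1r mul1r.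
Qed.

(** A pointwise minimal sublinear function below [p] is additive, hence odd and linear. Zorn's lemma
    provides it, for the order in which larger means pointwise smaller. *)
Lemma hahn_banach (R : realType) (V : lmodType R) (p : V -> R) :
  sublinear p ->
  exists v : V -> R^o, linear v /\ forall x, v x <= p x.
Proof.
move=> sp.
pose P (q : V -> R) := sublinear q /\ forall x, q x <= p x.
pose T := {q | P q}.
pose rel (q1 q2 : T) := `[< forall x, sval q2 x <= sval q1 x >].
have [] := @Zorn T rel.
- by move=> t; apply/asboolP.
- by move=> r s t /asboolP rs /asboolP st; apply/asboolP => x;
    exact: le_trans (st x) (rs x).
- move=> [s hs] [t ht] /asboolP/= st /asboolP/= ts.
  apply: eq_exist => /=; apply/funext => x; apply/eqP.
  by rewrite eq_le ts st.
- move=> A Atot.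
  have [[q0 Aq0]|A0] := pselect (A !=set0); last first.
    exists (exist P p (conj sp (fun x => lexx (p x)))) => s As.
    by exfalso; apply: A0; exists s.
  pose S x := [set sval q x | q in A].
  have Sb x : has_lbound (S x).
    exists (- p (- x)) => _ [[q [sq qp]] _ <-] /=.
    have := sq.1 x (- x); rewrite subrr sublinear0//.
    have := qp (- x); lra.
  have sS : sublinear (fun x => inf (S x)).
    apply: sublinear_inf => //.
    + by move=> x; exists (sval q0 x); exists q0.
    + move=> x y _ _ [q Aq <-] [q' Aq' <-].
      have [/asboolP qq'|/asboolP qq'] := Atot _ _ Aq Aq'.
        exists (sval q' (x + y)); first by exists q'.
        apply: le_trans ((proj2_sig q').1.1 _ _) _.
        by rewrite lerD2r.
      exists (sval q (x + y)); first by exists q.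
      apply: le_trans ((proj2_sig q).1.1 _ _) _.
      by rewrite lerD2l.
    + move=> t x _ t0 [q Aq <-]; exists (sval q (t *: x)); first by exists q.
      exact: (proj2_sig q).1.2.
  have Sp x : inf (S x) <= p x.
    by apply: le_trans ((proj2_sig q0).2 x); apply: ge_inf => //; exists q0.
  exists (exist P _ (conj sS Sp)) => s As; apply/asboolP => x /=.
  by apply: ge_inf => //; exists s.
move=> [v [sv vp]] vmin.
have vD := @minimal_sublinear_additive R V v sv.
have {vmin}/vD {}vD : forall q, sublinear q -> (forall x, q x <= v x) -> q = v.
  move=> q sq qv.
  have qp x : q x <= p x := le_trans (qv x) (vp x).
  have := vmin (exist P q (conj sq qp)).
  by move=> /(_ (introT (asboolP _) qv)) /(congr1 sval).
exists v; split=> //.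
have vN x : v (- x) = - v x.
  by apply/eqP; rewrite -addr_eq0 -vD addNr sublinear0.
move=> a x y; rewrite vD; congr (_ + _).
have [a0|a0] := leP 0 a; first exact: sublinear_homogeneous.
by rewrite -[a]opprK scaleNr vN (sublinear_homogeneous _ sv) ?oppr_ge0 ?ltW// scaleNr.
Qed.

(** * Ekeland's variational principle *)

(** Each iterate nearly minimizes [h] over the set [S] of the previous one. These sets are nested
    and shrink to the limit, so no other point lies below the limit. *)
Lemma ekeland (R : realType) (X : completeNormedModType R) (D : set X)
    (h : X -> R) (m c : R) (x0 : X) :
  0 < c -> (forall a, closed (D `&` [set x | h x <= a])) ->
  (forall x, D x -> m <= h x) -> D x0 ->
  exists y, [/\ D y, h y + c * `|x0 - y| <= h x0
    & forall z, D z -> h y <= h z + c * `|y - z|].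
Proof.
move=> c0 hcl hm Dx0.
pose S x := [set z | D z /\ h z + c * `|x - z| <= h x].
have Sxx x : D x -> S x x by move=> Dx; split=> //; rewrite subrr normr0 mulr0 addr0.
have Strans x y z : S x y -> S y z -> S x z.
  move=> [Dy xy] [Dz yz]; split=> //.
  have := ler_wpM2l (ltW c0) (ler_distD y x z); lra.
(* Choice over pairs lets the tolerance [1 / (n + 1)] depend on the step; outside [D] the value is a
   dummy. *)
have [F FP] : {F : nat * X -> X & forall nx, D nx.2 -> S nx.2 (F nx) /\
    forall w, S nx.2 w -> h (F nx) <= h w + nx.1.+1%:R^-1}.
  apply: (@choice _ _ (fun nx z => D nx.2 -> S nx.2 z /\
    forall w, S nx.2 w -> h z <= h w + nx.1.+1%:R^-1)) => -[n x] /=.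
  have [Dx|nDx] := pselect (D x); last by exists x => /nDx.
  pose A := h @` S x.
  have Alb : has_lbound A by exists m => _ [z [Dz _] <-]; exact: hm.
  have Ainf : has_inf A by split=> //; exists (h x); exists x => //; exact: Sxx.
  have n0 : 0 < n.+1%:R^-1 :> R by rewrite invr_gt0.
  have [_ [z Sz <-] hz] := inf_adherent n0 Ainf.
  exists z => _; split=> // w Sw; apply: ltW; apply: lt_le_trans hz _.
  by rewrite lerD2r; apply: ge_inf => //; exists w.
pose x_ := fix x_ n := if n is k.+1 then F (k, x_ k) else x0.
have Dx n : D (x_ n) by elim: n => //= n Dx; exact: (FP (n, _) Dx).1.1.
have Smono n k : (n <= k)%N -> S (x_ n) (x_ k).
  move=> /subnK <-; elim: (k - n)%N => [|j IH]; first exact: Sxx.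
  by apply: Strans IH _; exact: (FP (_, _) (Dx _)).1.
have Ssmall n z : S (x_ n.+1) z -> c * `|x_ n.+1 - z| <= n.+1%:R^-1.
  move=> Sz; have Snz := Strans _ _ _ (Smono n n.+1 (leqnSn n)) Sz.
  have h1 : h (x_ n.+1) <= h z + n.+1%:R^-1 := (FP (n, x_ n) (Dx n)).2 z Snz.
  have h2 : h z + c * `|x_ n.+1 - z| <= h (x_ n.+1) := Sz.2.
  by rewrite -(lerD2l (h z)); exact: le_trans h2 h1.
have /cvg_ex[l xl] : cvg (x_ n @[n --> \oo]).
  apply: cauchy_cvg; apply: cauchy_exP => e e0.
  have ce0 : 0 < c * e by rewrite mulr_gt0.
  have [N _ /(_ N (leqnn N)) /= hN] := near_infty_natSinv_lt (PosNum ce0).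
  exists (x_ N.+1); exists N.+1 => // k /= Nk.
  rewrite /= -ball_normE /= -(ltr_pM2l c0); apply: le_lt_trans hN.
  exact/Ssmall/Smono.
have Sl n : S (x_ n) l.
  (* All late iterates lie in this closed sublevel set; the slack [e] pays for replacing [x_ k] by
     [l] in the distance. *)
  have Hl e : 0 < e -> D l /\ h l <= h (x_ n) - c * `|x_ n - l| + e.
    move=> e0.
    have ec0 : 0 < e / c by rewrite divr_gt0.
    suff : (D `&` [set x | h x <= h (x_ n) - c * `|x_ n - l| + e]) l by [].
    apply: (@closed_cvg _ _ \oo _ x_ _ (hcl _) _ l xl).
    move/cvgrPdist_lt : xl => /(_ _ ec0) xl; near=> k.
    have [Dk hk] : S (x_ n) (x_ k) by apply: Smono; near: k; exact: nbhs_infty_ge.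
    split=> //=.
    have : `|l - x_ k| < e / c by near: k.
    rewrite ltr_pdivlMr// [_ * c]mulrC => lk.
    have := ler_wpM2l (ltW c0) (ler_distD (x_ k) (x_ n) l).
    rewrite (distrC (x_ k)); lra.
  split; first by have [] := Hl 1 ltr01.
  apply/ler_addgt0Pr => e /Hl [_]; lra.
exists l; split; [exact: (Sl 0%N).1|exact: (Sl 0%N).2|].
move=> z Dz; rewrite leNgt; apply/negP => hz.
(* A violating [z] lies, like [l], in every [S (x_ n.+1)], so both are within [1 / (c (n + 1))] of
   [x_ n.+1]. *)
have Slz : S l z by split=> //; exact: ltW.
suff : l = z by move=> lz; rewrite lz subrr normr0 mulr0 addr0 ltxx in hz.
apply/eqP; rewrite -subr_eq0 -normr_le0; apply/ler_addgt0Pr => e e0.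
have ce0 : 0 < c * e / 2 by rewrite divr_gt0// mulr_gt0.
have [n _ /(_ n (leqnn n)) /= hn] := near_infty_natSinv_lt (PosNum ce0).
have h1 := Ssmall n _ (Sl _).
have h2 := Ssmall n _ (Strans _ _ _ (Sl _) Slz).
have h3 := ler_wpM2l (ltW c0) (ler_distD (x_ n.+1) l z).
rewrite (distrC l (x_ n.+1)) in h3.
rewrite add0r -(ler_pM2l c0); move: (le_lt_trans h1 hn) (le_lt_trans h2 hn); lra.
Unshelve. all: by end_near. Qed.

(** * Right derivative of a convex function *)

(** By convexity the difference quotients at [t] are nondecreasing in the step and at least
    [phi t / t], the slope of the chord from 0. Monotonicity also makes the [lim] in
    [right_derivative] a genuine limit. *)
Lemma convex_le_right_derivative (R : realType) (phi : R -> R) (t : R) :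
  convex_function (E := R^o) [set t : R | 0 <= t] phi -> phi 0 = 0 ->
  0 < t -> phi t <= t * right_derivative phi t.
Proof.
move=> cphi phi0 t0.
have cvx (p x y : R) : 0 <= p <= 1 -> 0 <= x -> 0 <= y ->
    phi (p * x + (1 - p) * y) <= p * phi x + (1 - p) * phi y.
  move=> /andP[p0 p1] x0 y0.
  have pi01 : Itv.spec (@Itv.num_sem R) (Itv.Real `[0%Z, 1%Z]) p.
    by apply/and3P; split; rewrite ?num_real//= in_itv/= p0.
  have := cphi (Itv.mk pi01) x y; rewrite !inE => /(_ x0 y0).
  by rewrite !convRE.
pose q s := (phi (t + s) - phi t) / s.
have qmono : {in Interval (BRight 0) +oo%O &, {homo q : x y / x <= y}}.
  move=> x y; rewrite !in_itv/= !andbT => x0 y0 xy.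
  have xy01 : 0 <= x / y <= 1.
    by apply/andP; split; [rewrite divr_ge0// ltW|rewrite ler_pdivrMr// mul1r].
  have := cvx (x / y) (t + y) t xy01 ltac:(lra) (ltW t0).
  have -> : x / y * (t + y) + (1 - x / y) * t = t + x.
    by rewrite mulrDr mulrBl mul1r divfK ?gt_eqF//; lra.
  rewrite /q ler_pdivrMr// mulrAC -mulrA [x / y]mulrC => ?; lra.
have qge s : 0 < s -> phi t / t <= q s.
  move=> s0.
  have ts0 : 0 < t + s by lra.
  have ts01 : 0 <= t / (t + s) <= 1.
    apply/andP; split; first by rewrite divr_ge0// ltW.
    by rewrite ler_pdivrMr// mul1r; lra.
  have := cvx (t / (t + s)) (t + s) 0 ts01 (ltW ts0) (lexx _).
  rewrite mulr0 addr0 phi0 mulr0 addr0 divfK ?gt_eqF// => h.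
  have : phi t * (t + s) <= t * phi (t + s).
    by rewrite -ler_pdivlMr// mulrAC.
  rewrite /q ler_pdivlMr// mulrAC ler_pdivrMr//; lra.
have qlb : has_lbound [set q s | s in [set` Interval (BRight 0) +oo%O]].
  by exists (phi t / t) => _ [s /= + <-]; rewrite in_itv/= andbT; exact: qge.
have qcvg := nondecreasing_at_right_cvgr (b := +oo%O) isT qmono qlb.
rewrite mulrC -ler_pdivrMr//; apply: limr_ge; first by apply/cvg_ex; eexists; exact: qcvg.
near=> s; apply: qge; near: s; exact: nbhs_right_gt.
Unshelve. all: by end_near. Qed.

(** * Clarke tangents to the epigraph and the upper subderivative *)

Lemma dualD (R : realType) (X : normedModType R) (u : dual X) (x y : X) :
  u (x + y) = u x + u y.
Proof. by have := dual_linear u 1 x y; rewrite !scale1r. Qed.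

Lemma dualB (R : realType) (X : normedModType R) (u : dual X) (x y : X) :
  u (x - y) = u x - u y.
Proof. by rewrite dualD -scaleN1r dualZ mulN1r. Qed.

(* (h, b) lies in the Clarke tangent cone of the epigraph of f at (x, f x).  The
   condition on f u is one-sided: the other half of f u -> f x follows from
   u -> x by lower semicontinuity. *)
Definition epi_tangent (R : realType) (X : normedModType R) (f : X -> \bar R)
    (x h : X) (b : R) : Prop :=
  forall e : R, 0 < e -> exists2 r : R, 0 < r &
    forall (u : X) (t : R), `|x - u| < r -> (f u < f x + r%:E)%E -> 0 < t < r ->
      exists2 w, `|h - w| <= e & (f (u + t *: w)%R <= f u + (t * (b + e))%:E)%E.

Section epi_tangent.
Context (R : realType) (X : normedModType R) (f : X -> \bar R) (x : X).

Lemma epi_tangent0 : epi_tangent f x 0 0.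
Proof.
move=> e e0; exists 1 => // u t _ _ /andP[t0 _].
exists 0; first by rewrite subrr normr0 ltW.
by rewrite scaler0 addr0 add0r leeDl// lee_fin mulr_ge0// ltW.
Qed.

(** The condition is uniform in the base point: after a step along [h1] from [u], the point
    [u + t *: w1] is a valid base point for the step along [h2]. *)
Lemma epi_tangentD h1 h2 b1 b2 : f x \is a fin_num ->
  epi_tangent f x h1 b1 -> epi_tangent f x h2 b2 ->
  epi_tangent f x (h1 + h2) (b1 + b2).
Proof.
move=> fx T1 T2 e e0.
have e20 : 0 < e / 2 by rewrite divr_gt0.
have [r1 r10 {}T1] := T1 _ e20; have [r2 r20 {}T2] := T2 _ e20.
(* [K] dominates both the displacement rate [1 + |h1| + e] and the value rate [1 + |b1| + e], so
   [r * K <= r2] keeps the new base point within reach of [T2]. *)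
pose K := 1 + `|h1| + `|b1| + e.
have h10 := normr_ge0 h1; have b10 := normr_ge0 b1.
have K0 : 0 < K by rewrite /K; lra.
pose r := Order.min r1 (r2 / K).
have rr1 : r <= r1 by rewrite /r ge_min lexx.
have rK : r * K <= r2 by rewrite -ler_pdivlMr// /r ge_min lexx orbT.
have r0 : 0 < r by rewrite /r lt_min r10 divr_gt0.
exists r => // u t xu fu /andP[t0 tr].
have fu1 : (f u < f x + r1%:E)%E by apply: lt_le_trans fu _; rewrite leeD2l.
have [w1 hw1 fw1] := T1 u t (lt_le_trans xu rr1) fu1
  ltac:(by rewrite t0 (lt_le_trans tr)).
have r_le : r + r * (`|h1| + e) <= r2.
  apply: le_trans rK; rewrite /K !mulrDr mulr1.
  by have := mulr_ge0 (ltW r0) b10; lra.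
have r_le' : r + r * (`|b1| + e) <= r2.
  apply: le_trans rK; rewrite /K !mulrDr mulr1.
  by have := mulr_ge0 (ltW r0) h10; lra.
have re0 : 0 <= r * (`|h1| + e) by rewrite mulr_ge0//; lra.
have xu2 : `|x - (u + t *: w1)| < r2.
  rewrite opprD addrA; apply: le_lt_trans (ler_normB _ _) _.
  rewrite normrZ gtr0_norm//; apply: lt_le_trans r_le.
  apply: ltr_leD => //.
  have w1e : `|w1| <= `|h1| + e.
    by have := lerB_dist w1 h1; rewrite distrC; lra.
  by apply: ler_pM => //; exact: ltW.
have fu2 : (f (u + t *: w1)%R < f x + r2%:E)%E.
  apply: le_lt_trans fw1 _.
  apply: (@lt_le_trans _ _ (f x + r%:E + (r * (`|b1| + e))%:E)%E).
    apply: lte_leD => //.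
    rewrite lee_fin; apply: (@le_trans _ _ (t * (`|b1| + e))).
      by rewrite ler_pM2l//; have := ler_norm b1; lra.
    by apply: ler_wpM2r; [lra|exact: ltW].
  by rewrite -addeA -EFinD leeD2l.
have t2 : 0 < t < r2.
  by rewrite t0; lra.
have [w2 hw2 fw2] := T2 _ _ xu2 fu2 t2.
exists (w1 + w2).
  by rewrite opprD addrACA; have := ler_normD (h1 - w1) (h2 - w2); lra.
rewrite scalerDr addrA; apply: le_trans fw2 _.
apply: le_trans (leeD2r _ fw1) _.
rewrite -addeA -EFinD leeD2l// lee_fin -mulrDr ler_pM2l//; lra.
Qed.

Lemma epi_tangentZ a h b : f x \is a fin_num -> 0 < a ->
  epi_tangent f x h b -> epi_tangent f x (a *: h) (a * b).
Proof.
move=> fx a0 T e e0.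
have [r1 r10 {}T] := T (e / a) ltac:(by rewrite divr_gt0).
exists (Order.min r1 (r1 / a)); first by rewrite lt_min r10 divr_gt0.
move=> u t; rewrite !lt_min => /andP[xu _] fu /and3P[t0 _ tr].
have fu1 : (f u < f x + r1%:E)%E.
  by apply: lt_le_trans fu _; rewrite leeD2l// lee_fin ge_min lexx.
have [w hw fw] := T u (t * a) xu fu1 ltac:(by rewrite mulr_gt0//= -ltr_pdivlMr).
exists (a *: w).
  by rewrite -scalerBr normrZ gtr0_norm// mulrC -ler_pdivlMr.
rewrite scalerA (le_trans fw)// leeD2l// lee_fin -mulrA mulrDr.
by rewrite [a * (e / a)]mulrC divfK ?gt_eqF.
Qed.

(** A local minorant touching [f] at [x] is compared with the tangent condition at the base point
    [x] itself. This bound keeps the later inf-convolution finite. *)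
Lemma epi_tangent_ge (u : dual X) (c rho : R) h b :
  f x \is a fin_num -> 0 <= c -> 0 < rho ->
  (forall z, `|x - z| < rho ->
    ((fine (f x) + u (z - x) - c * `|x - z|)%:E <= f z)%E) ->
  epi_tangent f x h b -> u h - c * `|h| <= b.
Proof.
move=> fx c0 rho0 H T.
have M0 : 0 < 1 + `|u| + c by have := normr_ge0 u; lra.
apply/ler_addgt0Pr => e' e'0.
(* The errors add up to [e']: [e] from tangency, [|u| e] and [c e] from replacing [w] by [h]. *)
pose e := e' / (1 + `|u| + c).
have e0 : 0 < e by rewrite divr_gt0.
have eM : e * (1 + `|u| + c) = e' by rewrite /e divfK ?gt_eqF.
have [r r0 {}T] := T e e0.
have N0 : 0 < `|h| + e by have := normr_ge0 h; lra.
pose t := Order.min (r / 2) (rho / (2 * (`|h| + e))).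
have t0 : 0 < t by rewrite lt_min !divr_gt0// mulr_gt0.
have tr : t < r.
  by apply: (@le_lt_trans _ _ (r / 2)); [rewrite /t ge_min lexx|lra].
have trho : t * (`|h| + e) < rho.
  apply: (@le_lt_trans _ _ (rho / 2)); last lra.
  by rewrite -ler_pdivlMr// -mulrA -invfM /t ge_min lexx orbT.
have [w hw fw] := T x t ltac:(by rewrite subrr normr0)
  ltac:(by rewrite lteDl// lte_fin) ltac:(by rewrite t0).
have w1 : `|w| <= `|h| + e.
  by have := lerB_dist w h; rewrite distrC in hw *; lra.
have xz : x - (x + t *: w) = - (t *: w) by rewrite opprD addrA subrr add0r.
have zx : x + t *: w - x = t *: w by rewrite addrAC subrr add0r.
have nz : `|x - (x + t *: w)| = t * `|w|.
  by rewrite xz normrN normrZ gtr0_norm.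
have := H (x + t *: w) ltac:(by rewrite nz (le_lt_trans _ trho)// ler_pM2l).
move=> /le_trans/(_ fw); rewrite -{2}(fineK fx) -EFinD lee_fin nz zx dualZ.
rewrite -addrA lerD2l mulrCA -mulrBr ler_pM2l// => uwb.
have uhw : u h - u w <= `|u| * e.
  rewrite -dualB; apply: le_trans (ler_norm _) _.
  apply: le_trans (dual_norm_bound u _) _.
  by apply: ler_wpM2l => //; exact: dual_norm_ge0.
have := ler_wpM2l c0 w1.
rewrite mulrDr; move: eM; rewrite !mulrDr mulr1 [e * `|u|]mulrC [e * c]mulrC.
lra.
Qed.

(** The limsup grows as its ball shrinks, so the limit is a supremum and bounds the limsup at every
    single [e]. That limsup is an infimum over filter sets: one of them yields the radius, and the
    inner infimum yields [w]. *)
Lemma upper_subderivative_lt_tangent h b :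
  lower_semicontinuous f -> f x \is a fin_num ->
  (upper_subderivative f x h < b%:E)%E -> epi_tangent f x h b.
Proof.
move=> flsc fx fb e e0.
pose quot e (ut : X * R) :=
  ereal_inf [set ((f (ut.1 + ut.2 *: w)%R - f ut.1) * (ut.2^-1)%:E)%E
            | w in closed_ball_ Num.Def.normr h e].
pose L e := limf_esup (quot e) (filter_prod (f_attentive f x) 0^'+).
have Lmono : {in Interval (BRight 0) +oo%O &,
    {homo L : n m / (n <= m)%R >-> (m <= n)%E}}.
  move=> e1 e2 _ _ e12; rewrite /L /limf_esup; apply: le_ereal_inf_tmp => _ [V FV <-].
  apply: ge_ereal_inf; exists (ereal_sup (quot e2 @` V)); first by exists V.
  apply: ge_ereal_sup => _ [ut Vut <-].
  apply: (@le_trans _ _ (quot e1 ut)); last by apply: ereal_sup_ubound; exists ut.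
  apply: le_ereal_inf_tmp => _ [w hw <-]; apply: ge_ereal_inf.
  by eexists; [exists w; [exact: le_trans hw e12|reflexivity]|].
have Lcvg := nonincreasing_at_right_cvge +oo%O isT Lmono.
have Le : (L e < b%:E)%E.
  apply: le_lt_trans fb.
  rewrite /upper_subderivative (cvg_lim _ Lcvg)//.
  by apply: ereal_sup_ubound; exists e => //=; rewrite in_itv/= e0.
have /ereal_inf_lt[_ [V [[A B] [/= [W WN WA] B0] ABV] <-] Vb] := Le.
have [[W1 W2] /= [W1N W2N] W12] := WN.
move/nbhs_ballP : W1N => [r1 /= r10 xW1].
pose a := fine (f x); have fxa : f x = a%:E by rewrite fineK.
have {}W2N : nbhs a (W2 \o EFin) by move: W2N; rewrite fxa.
move/nbhs_ballP : W2N => [r2 /= r20 aW2].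
have /nbhs_ballP[r3 /= r30 xB] := B0.
have [V' /nbhs_ballP[r4 /= r40 xV'] V'f] : exists2 V, nbhs x V &
    forall y, V y -> ((a - r2)%:E < f y)%E.
  by apply: flsc; rewrite fxa lte_fin ltrBlDr ltrDl.
exists (Order.min (Order.min r1 r2) (Order.min r3 r4)).
  by rewrite !lt_min r10 r20 r30.
move=> u t; rewrite !lt_min => /andP[/andP[xu1 _] /andP[_ xu4]] fu.
move=> /andP[t0 /andP[_ /andP[tr3 _]]].
have {}V'u : ((a - r2)%:E < f u)%E by apply/V'f/xV'; rewrite -ball_normE.
have {}fu : (f u < (a + r2)%:E)%E.
  by apply: lt_le_trans fu _; rewrite fxa lee_fin lerD2l !ge_min lexx orbT.
have [d fud] : exists d, f u = d%:E.
  by move: V'u fu; case: (f u) => // d _ _; exists d.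
rewrite fud !lte_fin in V'u fu.
have VV : V (u, t).
  apply: ABV; split => /=.
    apply: WA => /=; apply: W12; split => /=.
      by apply: xW1; rewrite -ball_normE.
    rewrite fud; apply: aW2; rewrite -ball_normE /= ltr_norml; lra.
  apply: xB => //; rewrite -ball_normE /= sub0r normrN gtr0_norm//.
have : (quot e (u, t) < b%:E)%E.
  by apply: le_lt_trans Vb; apply: ereal_sup_ubound; exists (u, t).
move=> /ereal_inf_lt[_ [w /= hw <-]] fw; exists w => //.
move: fw => /=; rewrite fud; case: (f _) => [s||].
- rewrite -EFinB -EFinM lte_fin lee_fin ltr_pdivrMr// => fw.
  have := mulr_gt0 t0 e0; lra.
- by rewrite addye// gt0_mulye// lte_fin invr_gt0.
- by rewrite leNye.
Qed.

Lemma perturbed_min_subdifferential (u : dual X) (c rho : R) :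
  lower_semicontinuous f -> f x \is a fin_num -> 0 <= c -> 0 < rho ->
  (forall z, `|x - z| < rho ->
    ((fine (f x) + u (z - x) - c * `|x - z|)%:E <= f z)%E) ->
  exists2 v : dual X, subdifferential f x v & `|v - u| <= c.
Proof.
move=> flsc fx c0 rho0 H.
(* The inf-convolution of the upper subderivative with u + c |.| is finite and
   sublinear; a linear form below it is both below the upper subderivative and
   within c of u. *)
pose S h := [set wb.2 + u (h - wb.1) + c * `|h - wb.1|
            | wb in [set wb | epi_tangent f x wb.1 wb.2]].
have Sle h s : S h s -> u h - c * `|h| <= s.
  move=> [[w b] /= /(epi_tangent_ge fx c0 rho0 H) wb <-].
  rewrite dualB distrC.
  have := ler_wpM2l c0 (lerB_dist w h); rewrite mulrBr; lra.
have Sb h : has_lbound (S h) by exists (u h - c * `|h|) => s /Sle.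
(* The tangent [(0, 0)] puts [v] below [u + c |.|]; oddness of [v] then gives the distance bound and
   continuity. *)
have S0 h : S h (u h + c * `|h|).
  by exists (0, 0) => /=; [exact: epi_tangent0|rewrite !subr0 add0r].
have Ssub : sublinear (fun h => inf (S h)).
  apply: sublinear_inf => //.
  - by move=> h; exists (u h + c * `|h|).
  - move=> h1 h2 _ _ [[w1 b1] /= T1 <-] [[w2 b2] /= T2 <-].
    eexists; first by exists (w1 + w2, b1 + b2) => //=; exact: epi_tangentD.
    rewrite /= opprD [h1 + h2 + _]addrACA dualD.
    have := ler_wpM2l c0 (ler_normD (h1 - w1) (h2 - w2)); rewrite mulrDr; lra.
  - move=> t h _ t0 [[w b] /= T <-].
    eexists; first by exists (t *: w, t * b) => //=; exact: epi_tangentZ.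
    rewrite /= -scalerBr dualZ normrZ gtr0_norm//; lra.
have [v [vlin vS]] := hahn_banach Ssub.
have vu h : v h <= u h + c * `|h|.
  by apply: le_trans (vS h) _; apply: ge_inf.
have vD h1 h2 : v (h1 - h2) = v h1 - v h2.
  have -> : h1 - h2 = -1 *: h2 + h1 by rewrite scaleN1r addrC.
  by rewrite vlin scaleN1r addrC.
have vN h : v (- h) = - v h.
  have v0 : v 0 = 0 by rewrite -(subrr (0 : X)) vD subrr.
  by rewrite -sub0r vD v0 sub0r.
have vuc h : `|v h - u h| <= c * `|h|.
  have := vu (- h); rewrite vN normrN -[- h]sub0r dualB.
  have -> : u 0 = 0 by rewrite -(subrr (0 : X)) dualB subrr.
  have := vu h; rewrite ler_norml; lra.
have vcont : continuous v.
  move=> y; apply/cvgrPdist_lt => e e0.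
  have M0 : 0 < 1 + `|u| + c by have := normr_ge0 u; lra.
  apply/nbhs_ballP; exists (e / (1 + `|u| + c)) => /=; first exact: divr_gt0.
  move=> z; rewrite -ball_normE /= ltr_pdivlMr// => yz.
  rewrite -vD; apply: le_lt_trans yz.
  have := ler_norm (v (y - z) - u (y - z)).
  have := ler_normD (v (y - z) - u (y - z)) (u (y - z)); rewrite subrK.
  have := vuc (y - z).
  have : `|u (y - z)| <= `|u| * `|y - z| := dual_norm_bound u _.
  have := normr_ge0 (y - z).
  lra.
have vmem : v \in @continuous_linear_form R X by apply/asboolP.
exists (Dual vmem); last first.
  apply: dual_norm_le => y y1.
  have -> : (Dual vmem - u) y = v y - u y by [].
  by apply: le_trans (vuc y) _; rewrite ler_piMr.
split => [|h /=]; first by rewrite /effective_domain /= ltey_eq fx.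
rewrite leNgt; apply/negP => fv.
(* A real [b] strictly between makes [(h, b)] tangent, so [b] lies in [S h] and bounds [v h]. *)
have [b fb bv] : exists2 b, (upper_subderivative f x h < b%:E)%E & b < v h.
  move: fv; case: (upper_subderivative _ _ _) => [s|//|_].
    by rewrite lte_fin => sv; exists ((s + v h) / 2); rewrite ?lte_fin; lra.
  by exists (v h - 1); rewrite ?ltNyr//; lra.
have /upper_subderivative_lt_tangent T := fb.
have : v h <= b.
  apply: le_trans (vS h) _; apply: ge_inf => //; exists (h, b) => /=.
    exact: T.
  by rewrite subrr normr0 mulr0 -(subrr (0 : X)) dualB subrr !addr0.
by rewrite leNgt bv.
Qed.

End epi_tangent.

(** * Ekeland points of tilted functions and their subgradients *)

Lemma closed_tilt_sublevel (R : realType) (X : normedModType R)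
    (f : X -> \bar R) (u : dual X) (a : R) :
  lower_semicontinuous f -> closed [set z | (f z <= (a + u z)%:E)%E].
Proof.
move=> flsc; rewrite -openC openE => p /= /negP; rewrite -ltNge => hp.
have [e e0 he] : exists2 e : R, 0 < e & ((a + u p + e)%:E < f p)%E.
  case: (f p) hp => [s| |//]; last by exists 1; rewrite ?ltry.
  by rewrite lte_fin => sp; exists ((s - (a + u p)) / 2); rewrite ?lte_fin; lra.
have [V pV Vf] := flsc _ _ he.
have /cvgrPdist_lt /(_ _ e0) uN := @dual_continuous _ _ u p.
rewrite /interior; near=> z => /=; apply/negP; rewrite -ltNge.
apply: (@lt_trans _ _ (a + u p + e)%:E); last by apply: Vf; near: z.
have : `|u p - u z| < e by near: z.
by rewrite lte_fin ltr_norml => /andP[+ _]; lra.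
Unshelve. all: by end_near. Qed.

(** Ekeland's principle is applied where [f] is finite, to have real values; sublevel sets stay
    closed since finiteness is automatic there. An interior [y] minimizes the perturbed function on
    a full ball around it. *)
Lemma ekeland_subdifferential (R : realType) (X : completeNormedModType R)
    (f : X -> \bar R) (u : dual X) (xbar x0 : X) (rho m c : R) :
  lower_semicontinuous f -> (forall x, f x != -oo%E) -> 0 < c ->
  (forall z, `|xbar - z| <= rho -> ((m + u z)%:E <= f z)%E) ->
  `|xbar - x0| <= rho -> f x0 \is a fin_num ->
  exists y, [/\ `|xbar - y| <= rho, f y \is a fin_num,
      fine (f y) - u y + c * `|x0 - y| <= fine (f x0) - u x0
    & `|xbar - y| < rho ->
      exists2 v : dual X, subdifferential f y v & `|v - u| <= c].
Proof.
move=> flsc fNy c0 hm xx0 fx0.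
pose D := [set z | `|xbar - z| <= rho /\ f z \is a fin_num].
pose g z := fine (f z) - u z.
have Dcl a : closed (D `&` [set z | g z <= a]).
  rewrite [X in closed X](_ : _ = closed_ball_ Num.Def.normr xbar rho `&`
      [set z | (f z <= (a + u z)%:E)%E]); last first.
    apply/seteqP; split => z /=; rewrite /D /g /=.
      by move=> [[zr fz] ga]; split=> //; rewrite -(fineK fz) lee_fin; lra.
    move=> [zr fz]; have ffz : f z \is a fin_num.
      by rewrite fin_numE fNy/=; case: (f z) fz.
    by split=> //; move: fz; rewrite -{1}(fineK ffz) lee_fin; lra.
  apply: closedI; first exact: closed_closed_ball_.
  exact: closed_tilt_sublevel.
have gm z : D z -> m <= g z.
  move=> [/hm + fz]; rewrite -(fineK fz) lee_fin /g; lra.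
have [y [[yr fy] gy ymin]] := ekeland c0 Dcl gm (conj xx0 fx0).
exists y; split=> // yr'.
apply: (@perturbed_min_subdifferential _ _ _ _ _ _ (rho - `|xbar - y|)) => //.
- exact: ltW.
- by rewrite subr_gt0.
- move=> z yz; case fz : (f z) (fNy z) => [s| |]//= _; last by rewrite leey.
  have Dz : D z.
    split; last by rewrite fz.
    by have := ler_distD y xbar z; lra.
  have := ymin z Dz; rewrite /g fz /= lee_fin dualB; lra.
Qed.

(** * Consequences of metric regularity: growth and tilted minimizers *)

(** A nonempty preimage makes the distance finite, so [extend_infty psi] reduces to [psi], whose
    monotonicity applies to the lower bound [s]. *)
Lemma metric_regular_lower (R : realType) (X Y : normedModType R)
    (psi : R -> R) (F : X -> set Y) xbar ybar (r tau kappa s : R) x y v :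
  admissible psi -> metric_regular_ineq psi F xbar ybar r tau kappa ->
  0 <= tau -> 0 <= kappa -> 0 <= s ->
  ball xbar r x -> ball ybar r y -> F x v -> preimage_multi F y !=set0 ->
  (forall a, F a y -> s <= `|x - a|) ->
  psi (tau * s) <= kappa * `|y - v|.
Proof.
move=> [_ psi_mono _ _] reg tau0 kappa0 s0 xr yr Fxv [a0 Fa0] hs.
have := reg _ _ xr yr.
set d := dist_set x _.
have ds : (s%:E <= d)%E.
  by apply: le_ereal_inf_tmp => _ [a Fa <-]; rewrite lee_fin hs.
have dub : (d <= `|x - a0|%:E)%E by apply: ge_ereal_inf; exists `|x - a0|%:E => //; exists a0.
case: d ds dub => [d| |]//; rewrite !lee_fin => ds _ /=.
have dv : (dist_set y (F x) <= `|y - v|%:E)%E.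
  by apply: ge_ereal_inf; exists `|y - v|%:E => //; exists v.
move=> /le_trans /(_ (lee_wpmul2l _ dv)); rewrite !lee_fin => /(_ kappa0).
by apply: le_trans; apply: psi_mono; [exact: mulr_ge0|exact: ler_wpM2l].
Qed.

(** Otherwise the constant sequence [t] would violate the last clause of admissibility. *)
Lemma admissible_gt0 (R : realType) (phi : R -> R) (t : R) :
  admissible phi -> 0 < t -> 0 < phi t.
Proof.
move=> [phi0 _ _ phiP] t0; rewrite lt_neqAle phi0 ?ltW// andbT.
apply/eqP => pt.
have : (fun _ : nat => t) n @[n --> \oo] --> 0.
  by apply: phiP => [n|]; [exact: ltW|rewrite -pt; exact: cvg_cst].
move=> /(cvg_lim (@Rhausdorff R)); rewrite (cvg_lim (@Rhausdorff R) (cvg_cst t)).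
by move=> t00; rewrite t00 ltxx in t0.
Qed.

Section regular_subdifferential.
Context (R : realType) (X : completeNormedModType R) (phi : R -> R)
  (f : X -> \bar R) (xbar : X) (r tau kappa delta : R).
Context (phi_admissible : admissible phi)
  (phi_convex : convex_function (E := R^o) [set t : R | 0 <= t] phi)
  (dphi_admissible : admissible (right_derivative phi))
  (f_lsc : lower_semicontinuous f) (fNy : forall x, f x != -oo%E)
  (tau0 : 0 < tau) (kappa0 : 0 < kappa)
  (reg : metric_regular_ineq (right_derivative phi) (subdifferential f)
    xbar (0 : dual X) r tau kappa).
Implicit Types (u : dual X) (a : X).

(** Ekeland's principle runs on the ball of radius [4 * rho]. Since [t <= 2 * rho], its point [y] is
    within [2 * rho] of [xbar], hence interior. The constants do not depend on [u] or [a]. *)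
Lemma regular_growth rho u a :
  0 < rho -> 5 * rho <= delta -> 5 * rho <= r -> `|u| < r ->
  preimage_multi (subdifferential f) u `&` ball xbar delta = [set a] ->
  `|xbar - a| <= rho ->
  (forall z, `|xbar - z| <= 4 * rho -> (f a + (u (z - a) : R)%:E <= f z)%E) ->
  forall x, `|xbar - x| <= rho ->
    ((phi (tau / 2 * `|x - a|))%:E
       <= (2 * kappa * tau)%:E * (tilt f u x - tilt f u a))%E.
Proof.
move=> rho0 rdelta rr ur ua ax amin x xx.
have au : subdifferential f a u.
  by have : [set a] a by []; rewrite -ua => -[].
have [fa_lt _] := au.
have [fa fae] : exists s, f a = s%:E.
  by move: fa_lt (fNy a); rewrite /effective_domain /=; case: (f a) => // s; exists s.
have K0 : 0 < 2 * kappa * tau by rewrite !mulr_gt0.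
rewrite /tilt fae; case fx : (f x) (fNy x) => [s| |]//= _; last first.
  by rewrite addye// gt0_muley ?leey// lte_fin.
rewrite -!EFinB -EFinM lee_fin leNgt; apply/negP => hlt.
have [xa|xa] := eqVneq x a.
  move: fx hlt; rewrite xa fae => -[->]; rewrite !subrr normr0 !mulr0.
  by have [_ _ -> _] := phi_admissible; rewrite ltxx.
set t := `|x - a| in hlt.
have t0 : 0 < t by rewrite normr_gt0 subr_eq0.
have tt0 : 0 < tau / 2 * t by rewrite !mulr_gt0// invr_gt0.
(* Chosen so that the failure of growth [hlt] puts the gap of the tilted values below
   [c * (t / 2)]. *)
pose c := phi (tau / 2 * t) / (kappa * tau * t).
have kt0 : 0 < kappa * tau * t by rewrite !mulr_gt0.
have c0 : 0 < c by rewrite divr_gt0// admissible_gt0.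
have cE : c * (kappa * tau * t) = phi (tau / 2 * t) by rewrite /c divfK ?gt_eqF.
have t2 : t <= 2 * rho.
  by have := ler_distD xbar x a; rewrite (distrC x xbar) -/t; lra.
have hm z : `|xbar - z| <= 4 * rho -> ((fa - u a + u z)%:E <= f z)%E.
  by move/amin; apply: le_trans; rewrite fae lee_fin dualB; lra.
have fxfin : f x \is a fin_num by rewrite fx.
have xx4 : `|xbar - x| <= 4 * rho by lra.
have [y [yr fy gy yv]] := ekeland_subdifferential f_lsc fNy c0 hm xx4 fxfin.
have cxy : c * `|x - y| < c * (t / 2).
  have ha : fa - u a + u y <= fine (f y) by have := hm y yr; rewrite -{1}(fineK fy) lee_fin.
  have h1 : c * `|x - y| <= s - u x - (fa - u a) by move: gy; rewrite fx /=; lra.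
  apply: le_lt_trans h1 _.
  rewrite -(ltr_pM2l K0); apply: lt_le_trans hlt _; rewrite -cE; lra.
rewrite ltr_pM2l// in cxy.
have yr2 : `|xbar - y| < 2 * rho by have := ler_distD x xbar y; lra.
have [v vy vu] := yv ltac:(lra).
have ya : t / 2 <= `|y - a|.
  by have := ler_distD y x a; rewrite -/t; lra.
(* Solutions outside the [delta] ball are at least [5 * rho - 2 * rho] away from [y], more than
   [t / 2]. *)
have hs b : subdifferential f b u -> t / 2 <= `|y - b|.
  move=> bu; have [bd|bd] := ltP `|xbar - b| delta.
    suff -> : b = a by [].
    have : [set a] b by rewrite -ua; split=> //; rewrite -ball_normE.
    by [].
  by have := ler_distD y xbar b; lra.
have : right_derivative phi (tau * (t / 2)) <= kappa * `|u - v|.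
  apply: (@metric_regular_lower _ _ _ _ _ xbar 0 r tau kappa (t / 2) y u v
    dphi_admissible reg) => //; try exact: ltW.
  - by rewrite divr_ge0// ltW.
  - by rewrite -ball_normE /=; lra.
  - by rewrite -ball_normE /= sub0r normrN.
  - by exists a.
rewrite distrC mulrA mulrAC => h1.
have [_ _ phi0 _] := phi_admissible.
(* For [s = tau / 2 * t] this reads [phi s <= s * q <= s * kappa * c = phi s / 2], impossible for
   positive [phi s]. *)
have h2 := convex_le_right_derivative phi_convex phi0 tt0.
have q0 := admissible_gt0 dphi_admissible tt0.
set q := right_derivative phi _ in h1 h2 q0.
have h3 : q <= kappa * c by apply: le_trans h1 _; rewrite ler_pM2l.
have tt : 0 < tau * t by rewrite mulr_gt0.
have h4 := ler_wpM2l (ltW tt) h3.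
have h5 := mulr_gt0 tt q0.
rewrite -cE in h2; lra.
Qed.

(** The barrier [eta] on the outer shell exceeds what the tilt [u] can gain, so points no worse than
    [xbar] stay within [sigma]. Ekeland points are then interior and carry subgradients. *)
Lemma regular_tilted_minimizer rho sigma eta u a :
  0 < sigma -> sigma < rho -> rho <= r -> rho <= delta -> `|u| < r ->
  `|u| * rho < eta -> f xbar \is a fin_num ->
  (forall x, `|xbar - x| <= rho -> (f xbar <= f x)%E) ->
  (forall x, sigma <= `|xbar - x| -> `|xbar - x| <= rho ->
    (f xbar + eta%:E <= f x)%E) ->
  preimage_multi (subdifferential f) u `&` ball xbar delta = [set a] ->
  `|xbar - a| <= sigma /\
  forall z, `|xbar - z| <= rho -> (f a + (u (z - a) : R)%:E <= f z)%E.
Proof.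
move=> sigma0 sigma_rho rhor rhodelta ur ueta fxbar xbar_min xbar_sharp ua.
have au : subdifferential f a u.
  by have : [set a] a by []; rewrite -ua => -[].
pose g z := fine (f z) - u z.
have uB y : `|xbar - y| <= rho -> u y - u xbar <= `|u| * rho.
  move=> yr; rewrite -dualB; apply: le_trans (ler_norm _) _.
  apply: le_trans (dual_norm_bound u _) _; rewrite distrC.
  by apply: ler_wpM2l => //; exact: dual_norm_ge0.
have near_xbar y : `|xbar - y| <= rho -> f y \is a fin_num ->
    g y <= g xbar -> `|xbar - y| < sigma.
  move=> yr fy; rewrite /g => gy; rewrite ltNge; apply/negP => sy.
  have := xbar_sharp y sy yr; rewrite -(fineK fxbar) -(fineK fy) -EFinD lee_fin.
  have := uB y yr; lra.
have approx z e : `|xbar - z| <= rho -> f z \is a fin_num -> g z <= g xbar ->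
    0 < e -> e <= rho - sigma ->
    exists y, [/\ `|y - a| < e, f y \is a fin_num, g y <= g z & `|xbar - y| < sigma].
  move=> zr fz gz e0 er.
  have te0 : 0 < tau * e by rewrite mulr_gt0.
  have q0 := admissible_gt0 dphi_admissible te0.
  (* If [y] were at distance at least [e] from [a], regularity would bound the positive value
     [phi'_+ (tau * e)] by [kappa * c], its own half. *)
  pose c := right_derivative phi (tau * e) / (2 * kappa).
  have k20 : 0 < 2 * kappa by rewrite mulr_gt0.
  have c0 : 0 < c by rewrite divr_gt0.
  have cE : c * (2 * kappa) = right_derivative phi (tau * e).
    by rewrite /c divfK ?gt_eqF.
  have hm w : `|xbar - w| <= rho ->
      ((fine (f xbar) - u xbar - `|u| * rho + u w)%:E <= f w)%E.
    move=> wr; apply: le_trans (xbar_min w wr); rewrite -{2}(fineK fxbar) lee_fin.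
    by have := uB w wr; lra.
  have [y [yr fy gy yv]] := ekeland_subdifferential f_lsc fNy c0 hm zr fz.
  have gyz : g y <= g z.
    by have := mulr_ge0 (ltW c0) (normr_ge0 (z - y)); rewrite /g; lra.
  have ys := near_xbar y yr fy (le_trans gyz gz).
  exists y; split=> //; rewrite ltNge; apply/negP => eya.
  have [v vy vu] := yv (lt_trans ys sigma_rho).
  have hs b : subdifferential f b u -> e <= `|y - b|.
    move=> bu; have [bd|bd] := ltP `|xbar - b| delta.
      suff -> : b = a by [].
      have : [set a] b by rewrite -ua; split=> //; rewrite -ball_normE.
      by [].
    by have := ler_distD y xbar b; lra.
  have : right_derivative phi (tau * e) <= kappa * `|u - v|.
    apply: (@metric_regular_lower _ _ _ _ _ xbar 0 r tau kappa e y u v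
      dphi_admissible reg) => //; try exact: ltW.
    - by rewrite -ball_normE /=; lra.
    - by rewrite -ball_normE /= sub0r normrN.
    - by exists a.
  rewrite distrC => h1.
  have := ler_wpM2l (ltW kappa0) vu; lra.
have xbar0 : `|xbar - xbar| <= rho by rewrite subrr normr0; lra.
have d0 : 0 < rho - sigma by lra.
have a_le z : `|xbar - z| <= rho -> f z \is a fin_num -> g z <= g xbar ->
    (f a <= (g z + u a)%:E)%E.
  move=> zr fz gz.
  suff : [set x | (f x <= (g z + u x)%:E)%E] a by [].
  have cl := @closed_tilt_sublevel _ _ f u (g z) f_lsc.
  (* Ekeland points no worse than [z] accumulate at [a], so the closed sublevel set contains [a]. *)
  rewrite closure_id in cl; rewrite cl => B /nbhs_ballP[e /= e0 aB].
  have [||y [ya fy gy _]] := approx z (Order.min e (rho - sigma)) zr fz gz.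
  - by rewrite lt_min e0.
  - by rewrite ge_min lexx orbT.
  exists y; split => /=; last first.
    by apply: aB; rewrite -ball_normE /= distrC (lt_le_trans ya)// ge_min lexx.
  by rewrite -(fineK fy) lee_fin; move: gy; rewrite /g; lra.
split.
  apply/ler_addgt0Pr => e e0.
  have [||y [ya _ _ ys]] :=
    approx xbar (Order.min e (rho - sigma)) xbar0 fxbar (lexx _).
  - by rewrite lt_min e0.
  - by rewrite ge_min lexx orbT.
  have ye : `|y - a| < e by rewrite (lt_le_trans ya)// ge_min lexx.
  by have := ler_distD y xbar a; lra.
move=> z zr; case fz : (f z) (fNy z) => [s| |]//= _; last by rewrite leey.
have fzf : f z \is a fin_num by rewrite fz.
have {}fz : s = fine (f z) by rewrite fz.
(* [a_le] covers only points no worse than [xbar]; the others are compared through [xbar] itself,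
   hence the minimum. *)
have fa : (f a <= (Order.min (g z) (g xbar) + u a)%:E)%E.
  have [gz|gz] := leP (g z) (g xbar); first exact: a_le.
  exact: a_le.
apply: le_trans (leeD2r _ fa) _; rewrite -EFinD lee_fin dualB fz.
have : Order.min (g z) (g xbar) <= g z by rewrite ge_min lexx.
rewrite /g; lra.
Qed.

End regular_subdifferential.

Theorem theorem3p3 (R : realType) (X : completeNormedModType R)
  (phi : R -> R) (f : X -> \bar R) (xbar : X)
  (phi_admissible : admissible phi)
  (phi_convex : convex_function (E := R^o) [set t : R | 0 <= t] phi)
  (f_proper : proper_function f)
  (f_lsc : lower_semicontinuous f)
  (xbar_dom : effective_domain f xbar)
  (xbar_min : local_minimizer f xbar)
  (f_regular : strongly_metrically_regular (right_derivative phi)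
     (subdifferential f) xbar (0 : dual X)) :
  SLWP phi f xbar.
Proof.
have [fNy _] := f_proper.
have [dphi_admissible xbar0] := f_regular.
move=> [r [tau [kappa [delta [[r0 tau0 kappa0 delta0] reg single]]]]].
have fxbar : f xbar \is a fin_num.
  by rewrite fin_numE fNy/=; move: xbar_dom; rewrite /effective_domain /= ltey.
have [rho0 /= rho00 min_xbar] : exists2 e : R, 0 < e &
    forall x, `|xbar - x| < e -> (f xbar <= f x)%E.
  have /nbhs_ballP[e /= e0 he] := xbar_min.
  by exists e => // x xe; apply: he; rewrite -ball_normE.
(* The factor 5 is what [regular_growth] asks of [delta] and [r]; with [rho0] it makes [xbar]
   minimal on the ball of radius [4 * rho]. *)
pose rho := Order.min (Order.min delta r) rho0 / 5.
have rho_gt0 : 0 < rho by rewrite divr_gt0// !lt_min delta0 r0.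
have rho5 : [/\ 5 * rho <= delta, 5 * rho <= r & 5 * rho <= rho0].
  by rewrite /rho mulrC divfK// !ge_min !lexx !orbT.
have [rho_delta rho_r rho_rho0] := rho5.
have u0 z : (0 : dual X) z = 0 by [].
have ball0 u : `|u| < r -> ball (0 : dual X) r u.
  by move=> ur; rewrite -ball_normE /= sub0r normrN.
have xbar_single : preimage_multi (subdifferential f) (0 : dual X) `&`
    ball xbar delta = [set xbar].
  have [a a0] := single 0 (ballxx _ r0); rewrite a0.
  have : [set a] xbar by rewrite -a0; split=> //; exact: ballxx.
  by move=> ->.
pose K := 2 * kappa * tau.
have K0 : 0 < K by rewrite !mulr_gt0.
have growth x : `|xbar - x| <= rho ->
    (f xbar + (phi (tau / 2 * `|xbar - x|) / K)%:E <= f x)%E.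
  move=> xr.
  have := @regular_growth R X phi f xbar r tau kappa delta phi_admissible
    phi_convex dphi_admissible f_lsc fNy tau0 kappa0 reg rho 0 xbar rho_gt0
    rho_delta rho_r.
  rewrite normr0 subrr normr0 => /(_ r0 xbar_single (ltW rho_gt0)).
  have hmin z : `|xbar - z| <= 4 * rho ->
      (f xbar + ((0 : dual X) (z - xbar) : R)%:E <= f z)%E.
    by move=> zr; rewrite u0 adde0; apply: min_xbar; lra.
  move=> /(_ hmin x xr); rewrite /tilt !u0 !sube0 distrC -/K.
  rewrite -(fineK fxbar); case fx : (f x) (fNy x) => [s| |]//= _; last by rewrite leey.
  rewrite -EFinB -EFinM -EFinD !lee_fin => h.
  by rewrite -lerBrDl ler_pdivrMr// [leRHS]mulrC.
(* Growth at radius [sigma] needs minimality of [m u] up to [4 * sigma], which is exactly [rho]. *)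
pose sigma := rho / 4.
have sigma0 : 0 < sigma by rewrite divr_gt0.
have sigma_rho : sigma < rho by rewrite /sigma; lra.
have ts0 : 0 < tau / 2 * sigma by rewrite mulr_gt0// divr_gt0.
pose eta := phi (tau / 2 * sigma) / K.
have eta0 : 0 < eta by rewrite divr_gt0// admissible_gt0.
have sharp x : sigma <= `|xbar - x| -> `|xbar - x| <= rho ->
    (f xbar + eta%:E <= f x)%E.
  move=> sx /growth; apply: le_trans; rewrite leeD2l// lee_fin.
  rewrite ler_pM2r ?invr_gt0//.
  have [_ phi_mono _ _] := phi_admissible.
  by apply: phi_mono; [exact: ltW|rewrite ler_pM2l// divr_gt0].
(* The bound [r] keeps [u] in the regularity ball; [eta / rho] ensures [|u| * rho < eta]. *)
pose d := Order.min r (eta / rho).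
have d0 : 0 < d by rewrite lt_min r0 divr_gt0.
have [m mP] : {m : dual X -> X & forall u, `|u| < d ->
    preimage_multi (subdifferential f) u `&` ball xbar delta = [set m u]}.
  apply: (@choice _ _ (fun u a => `|u| < d ->
    preimage_multi (subdifferential f) u `&` ball xbar delta = [set a])) => u.
  have [ud|ud] := ltP `|u| d; last by exists xbar.
  have [|a ua] := single u; last by exists a.
  by apply: ball0; rewrite (lt_le_trans ud)// ge_min lexx.
exists d, sigma, K, (tau / 2); split; first by split=> //; exact: divr_gt0.
exists m; split.
  have : [set m 0] xbar.
    by rewrite -mP ?normr0//; split=> //; exact: ballxx.
  by move=> ->.
move=> u; rewrite -ball_normE /= sub0r normrN => ud.
have ur : `|u| < r by rewrite (lt_le_trans ud)// ge_min lexx.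
have ueta : `|u| * rho < eta.
  by rewrite -ltr_pdivlMr// (lt_le_trans ud)// ge_min lexx orbT.
have [||x xr|mu mu_min] := @regular_tilted_minimizer R X phi f xbar r tau kappa delta
  dphi_admissible f_lsc fNy tau0 kappa0 reg rho sigma eta u (m u) sigma0
  sigma_rho _ _ ur ueta fxbar _ sharp (mP u ud).
- lra.
- lra.
- by apply: min_xbar; lra.
split=> // x xs; rewrite -/K.
apply: (@regular_growth R X phi f xbar r tau kappa delta phi_admissible
  phi_convex dphi_admissible f_lsc fNy tau0 kappa0 reg sigma) => //.
- by rewrite /sigma; lra.
- by rewrite /sigma; lra.
- exact: mP.
- by move=> z zs; apply: mu_min; move: zs; rewrite /sigma; lra.
Qed.
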